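(* Let $X=Y\times\bar Y$ be a direct product of metric spaces. If a subset $C\subset X$ (with the induced metric) is affine, then so is the projection $P^Y(C)\subset Y$ (with the induced metric).
   Context: Direct product: $Y\times\bar Y$ is the Cartesian product with metric $d((y,\bar y),(y',\bar y'))=\sqrt{d^2(y,y')+d^2(\bar y,\bar y')}$, and $P^Y:X\to Y$ is the canonical projection. A metric space is affine if it is isometric to a linearly convex subset of a real normed vector space. *)

(* Defs.v *)
From HB Require Import structures.
From mathcomp Require Import all_boot all_order all_algebra.
From mathcomp Require Import all_classical all_reals all_analysis.
From mathcomp Require Import lra.

Set Implicit Arguments.
Unset Strict Implicit.
Unset Printing Implicit Defensive.

Import Order.TTheory GRing.Theory Num.Theory.
Import numFieldNormedType.Exports.

Local Open Scope classical_set_scope.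
Local Open Scope ring_scope.

(* Direct product of metric spaces. An alias of Y * Z is needed because the   *)
(* canonical pseudometric of Y * Z is the sup one.                            *)
Definition dprod (Y Z : Type) : Type := (Y * Z)%type.

Definition dprod_fst (Y Z : Type) (x : dprod Y Z) : Y := x.1.

HB.instance Definition _ (Y Z : choiceType) :=
  Choice.copy (dprod Y Z) (Y * Z)%type.

Section dprod_metric.
Context {R : realType} {Y Z : metricType R}.

Definition dprod_dist (p q : dprod Y Z) : R :=
  Num.sqrt (mdist p.1 q.1 ^+ 2 + mdist p.2 q.2 ^+ 2).

Let dprod_distxx p : dprod_dist p p = 0.
Proof. by rewrite /dprod_dist !mdistxx !expr0n addr0 sqrtr0. Qed.

Let dprod_dist_positivity p q : dprod_dist p q = 0 -> p = q.
Proof.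
case: p q => [y z] [y' z'] /eqP; rewrite sqrtr_eq0 /= => le0.
have := sqr_ge0 (mdist y y'); have := sqr_ge0 (mdist z z') => h1 h2.
have /eqP : mdist y y' ^+ 2 = 0 by lra.
have /eqP : mdist z z' ^+ 2 = 0 by lra.
by rewrite !sqrf_eq0 => /eqP/mdist_positivity -> /eqP/mdist_positivity ->.
Qed.

Let dprod_dist_sym p q : dprod_dist p q = dprod_dist q p.
Proof. by rewrite /dprod_dist (metric_sym p.1) (metric_sym p.2). Qed.

Let minkowski2 (a b c d : R) :
  Num.sqrt ((a + b) ^+ 2 + (c + d) ^+ 2) <=
  Num.sqrt (a ^+ 2 + c ^+ 2) + Num.sqrt (b ^+ 2 + d ^+ 2).
Proof.
set s := Num.sqrt (a ^+ 2 + c ^+ 2); set t := Num.sqrt (b ^+ 2 + d ^+ 2).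
have s0 : 0 <= s := sqrtr_ge0 _.
have t0 : 0 <= t := sqrtr_ge0 _.
have sE : s ^+ 2 = a ^+ 2 + c ^+ 2 by rewrite sqr_sqrtr// addr_ge0 ?sqr_ge0.
have tE : t ^+ 2 = b ^+ 2 + d ^+ 2 by rewrite sqr_sqrtr// addr_ge0 ?sqr_ge0.
have CS : a * b + c * d <= s * t.
  rewrite (le_trans (ler_norm _))// -ler_sqr ?nnegrE ?mulr_ge0//.
  rewrite real_normK ?num_real// exprMn sE tE.
  have := sqr_ge0 (a * d - c * b); rewrite !expr2; lra.
rewrite -[leRHS]ger0_norm ?addr_ge0// -sqrtr_sqr ler_wsqrtr//.
rewrite (sqrrD s) sE tE !expr2; lra.
Qed.

Let dprod_dist_triangle q p r :
  dprod_dist p r <= dprod_dist p q + dprod_dist q r.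
Proof.
apply: le_trans (minkowski2 _ _ _ _); rewrite /dprod_dist ler_wsqrtr//.
by rewrite lerD// ler_sqr ?nnegrE ?addr_ge0 ?mdist_ge0// metric_triangle.
Qed.

HB.instance Definition _ := isMetric.Build R (dprod Y Z)
  dprod_distxx dprod_dist_positivity dprod_dist_sym dprod_dist_triangle.

End dprod_metric.

(* The metric induced on a subset, compatible with the pseudometric structure *)
(* that the library already puts on set_type A.                               *)
Section induced_metric.
Context {R : realType} {X : metricType R} (A : set X).

Definition induced_dist (x y : set_type A) : R :=
  mdist (set_val x : X) (set_val y).

Let induced_dist_ge0 x y : 0 <= induced_dist x y.
Proof. exact: mdist_ge0. Qed.

Let induced_dist_positivity x y : induced_dist x y = 0 -> x = y.
Proof. by move/mdist_positivity/val_inj. Qed.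

Let ball_induced_dist (x : set_type A) (e : R) :
  ball x e = [set y | induced_dist x y < e].
Proof.
apply/seteqP; split=> y.
  by rewrite {1}/ball /= => h; move: h; rewrite /initial_ball ballEmdist.
by move=> h; rewrite /ball /= /initial_ball ballEmdist.
Qed.

HB.instance Definition _ := PseudoMetric_isMetric.Build R (set_type A)
  induced_dist_ge0 induced_dist_positivity ball_induced_dist.

End induced_metric.

(* A normed space as a metric space, for the distance |x - y|. The library    *)
(* makes normedModType inherit only from pseudoMetricType.                    *)
Definition normed_metric (R : realType) (V : normedModType R) : Type := V.

Section normed_metric.
Context {R : realType} (V : normedModType R).

HB.instance Definition _ := PseudoMetric.copy (normed_metric V) V.

Definition normed_dist (x y : normed_metric V) : R := `|(x : V) - y|.

Let normed_dist_ge0 x y : 0 <= normed_dist x y.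
Proof. exact: normr_ge0. Qed.

Let normed_dist_positivity x y : normed_dist x y = 0 -> x = y.
Proof. by move/normr0_eq0/eqP; rewrite subr_eq0 => /eqP. Qed.

Let ball_normed_dist (x : normed_metric V) (e : R) :
  ball x e = [set y | normed_dist x y < e].
Proof. by have := congr1 (fun b => b x e) (@ball_normE R V) => <-. Qed.

HB.instance Definition _ := PseudoMetric_isMetric.Build R (normed_metric V)
  normed_dist_ge0 normed_dist_positivity ball_normed_dist.

End normed_metric.

Definition isometric (R : realType) (M N : metricType R) : Prop :=
  exists2 f : M -> N, bijective f & {mono f : x y / mdist x y}.

Definition affine (R : realType) (M : metricType R) : Prop :=
  exists (V : normedModType R) (K : set V),
    convex_set K /\ isometric M (set_type (K : set (normed_metric V))).

(* Main.v *)
(* Let phi be the projection to Y, read on the convex set K isometric to C,   *)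
(* and rho (x, y) the distance of phi x and phi y. The equality case of       *)
(* Minkowski's inequality shows that rho is linear along every segment of K.  *)
(* This alone makes rho invariant under translations: if the sides xy and     *)
(* (x+w)(y+w) of a parallelogram are subdivided, the function                 *)
(* G c d = rho (x + c w, y + d w) satisfies inequalities at the crossings of  *)
(* the segments which, where G is smooth, say that G_c + G_d = 0; a           *)
(* telescoping sum over a grid replaces differentiation. So rho comes from a  *)
(* seminorm on the span of K - K, and the image of K in the quotient by the   *)
(* kernel of the seminorm is isometric to phi (K).                            *)
From HB Require Import structures.
Require Import Defs.
From mathcomp Require Import all_boot all_order all_algebra.
From mathcomp Require Import all_classical all_reals all_analysis.
From mathcomp Require Import ring lra.

Set Implicit Arguments.
Unset Strict Implicit.
Unset Printing Implicit Defensive.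

Import Order.TTheory GRing.Theory Num.Theory.
Import numFieldNormedType.Exports.

Local Open Scope classical_set_scope.
Local Open Scope ring_scope.

(** Squared distances add in the product, so equality in Minkowski's inequality along a segment of
    [K] makes the first coordinate move at constant speed ([l2_segment_split]): the projection read
    on [K] is [convex_affine]. For such a map, the triangle inequality at the common midpoint of two
    crossing segments yields translation invariance ([crossing_diagonal], [affine_dist_translate]).
    Distances then depend only on [x - y] and define a seminorm on the span of [K - K]
    ([diff_span_add_repr]); [seminorm_on_realization] divides out its kernel. *)

(** * Functions on a square with crossing inequalities *)

(* The two hypotheses bound each diagonal increment by the mixed second       *)
(* difference [mu] of its cell, and [mu] telescopes over the whole rectangle. *)
Lemma sum_band_le_total (R : realDomainType) (g : nat -> nat -> R) (N m : nat) :
    (forall i j, (i < N)%N -> (j < N + m)%N ->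
      2 * g i j <= g i j.+1 + g i.+1 j /\
      2 * g i.+1 j.+1 <= g i j.+1 + g i.+1 j) ->
  \sum_(0 <= k < m) `|g N (N + k)%N - g 0 k| <=
  (g 0 (N + m) - g 0 0) + (g N 0 - g N (N + m)).
Proof.
move=> cross.
pose mu i j := (g i j.+1 + g i.+1 j) - (g i j + g i.+1 j.+1).
have mu_ge0 i j : (i < N)%N -> (j < N + m)%N -> 0 <= mu i j.
  by move=> iN jn; have [] := cross i j iN jn; rewrite /mu; lra.
have diag i j : (i < N)%N -> (j < N + m)%N ->
    `|g i.+1 j.+1 - g i j| <= mu i j.
  by move=> iN jn; have [] := cross i j iN jn; rewrite ler_norml /mu; lra.
have -> : g 0 (N + m) - g 0 0 + (g N 0 - g N (N + m)) =
    \sum_(0 <= i < N) \sum_(0 <= j < N + m) mu i j.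
  pose r i := g i (N + m) - g i 0.
  under eq_big_nat => i iN.
    under eq_big_nat => j jn.
      have -> : mu i j = (g i j.+1 - g i.+1 j.+1) - (g i j - g i.+1 j).
        by rewrite /mu; ring.
      over.
    rewrite (telescope_sumr (fun j => g i j - g i.+1 j))//.
    have -> : g i (N + m) - g i.+1 (N + m) - (g i 0 - g i.+1 0) = - r i.+1 - - r i.
      by rewrite /r; ring.
    over.
  by rewrite (telescope_sumr (fun i => - r i))// /r; ring.
(* The m diagonals only meet the band of cells with i <= j < i + m; the other cells of the rectangle
   contribute [mu] >= 0. *)
apply: (@le_trans _ _
    (\sum_(0 <= k < m) \sum_(0 <= i < N) mu i (i + k)%N)).
  rewrite !big_nat; apply: ler_sum => k km.
  have -> : g N (N + k)%N - g 0 k =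
      \sum_(0 <= i < N) (g i.+1 (i + k).+1 - g i (i + k)%N).
    by rewrite (telescope_sumr (fun i => g i (i + k)%N)).
  apply: le_trans (ler_norm_sum _ _ _) _.
  rewrite !big_nat; apply: ler_sum => i iN.
  by apply: diag => //; rewrite -addSn leq_add// ltnW.
rewrite exchange_big/= !big_nat; apply: ler_sum => i iN.
have iNm : (i <= N + m)%N by rewrite (leq_trans (ltnW iN))// leq_addr.
have imNm : (i + m <= N + m)%N by rewrite leq_add2r ltnW.
rewrite [leRHS](big_cat_nat (n := i))//=.
rewrite [X in _ <= _ + X](big_cat_nat (n := (i + m)%N))//= ?leq_addr//.
have -> : \sum_(0 <= k < m) mu i (i + k)%N = \sum_(i <= j < i + m) mu i j.
  have := big_addn 0 (i + m) i predT (mu i); rewrite add0n addKn => ->.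
  by apply: eq_bigr => k _; rewrite addnC.
rewrite addrCA lerDl addr_ge0// big_nat sumr_ge0// => j.
  by move=> /andP[_ ji]; rewrite mu_ge0// (leq_trans ji).
by move=> /andP[_ ji]; rewrite mu_ge0.
Qed.

(* By [sum_band_le_total] on a grid of mesh 1/(m^2+m), the m diagonals close  *)
(* to the main one have end-to-end increments of bounded sum, each of which   *)
(* is |G 1 1 - G 0 0| up to O(1/m).                                           *)
Lemma crossing_diagonal (R : realType) (G : R -> R -> R) (L : R) :
    (forall c d e, 0 <= c -> 0 <= d -> 0 <= e -> c + e <= 1 -> d + e <= 1 ->
      2 * G c d <= G c (d + e) + G (c + e) d /\
      2 * G (c + e) (d + e) <= G c (d + e) + G (c + e) d) ->
    (forall c d c' d', 0 <= c <= 1 -> 0 <= d <= 1 -> 0 <= c' <= 1 ->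
      0 <= d' <= 1 -> `|G c d - G c' d'| <= L * (`|c - c'| + `|d - d'|)) ->
  G 0 0 = G 1 1.
Proof.
move=> cross lip.
have L0 : 0 <= L.
  have := lip 0 0 0 1; rewrite !subrr normr0 add0r sub0r normrN normr1 mulr1.
  by move/(_ ltac:(lra) ltac:(lra) ltac:(lra) ltac:(lra)); apply: le_trans.
(* The 5 is 2 from the total over the square (two sides, [L] each) plus 3 from moving the ends of
   the diagonals to the corners. *)
suff mD m : m%:R * `|G 1 1 - G 0 0| <= 5 * L.
  apply/esym/subr0_eq/normr0_eq0/eqP; rewrite eq_le normr_ge0 andbT leNgt.
  apply/negP => D0.
  have := mD (Num.bound (5 * L / `|G 1 1 - G 0 0|)).
  rewrite leNgt => /negP; apply; rewrite -ltr_pdivrMr//.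
  by rewrite archi_boundP// divr_ge0// mulr_ge0.
have [->|m_gt0] := posnP m; first by rewrite mul0r mulr_ge0.
(* With N = m^2 the band has width [x m] <= 1/m, so m errors of order [x m] add up to a bounded
   amount. *)
pose N := (m * m)%N; pose n := (N + m)%N.
have n0 : 0 < n%:R :> R by rewrite ltr0n addn_gt0 m_gt0 orbT.
pose x i : R := i%:R / n%:R.
have xS i : x i.+1 = x i + n%:R^-1 by rewrite /x -natr1 mulrDl mul1r.
have x0 i : 0 <= x i by rewrite divr_ge0.
have x1 i : (i <= n)%N -> x i <= 1 by move=> ?; rewrite ler_pdivrMr// mul1r ler_nat.
have xn : x n = 1 by rewrite /x divff// gt_eqF.
have x00 : x 0 = 0 by rewrite /x mul0r.
have xD i j : x (i + j)%N = x i + x j by rewrite /x natrD mulrDl.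
have mx : m%:R * x m <= 1.
  by rewrite /x mulrA ler_pdivrMr// mul1r -natrM ler_nat leq_addr.
have band := @sum_band_le_total R (fun i j => G (x i) (x j)) N m.
have {band} : \sum_(0 <= k < m) `|G (x N) (x (N + k)%N) - G (x 0) (x k)| <= 2 * L.
  apply: (le_trans (band _)).
    move=> i j iN jn; rewrite !xS; apply: cross => //.
    - by rewrite -xS x1// (leq_trans iN)// leq_addr.
    - by rewrite -xS x1.
  rewrite -/n xn x00 mulr_natl mulr2n lerD//.
    apply: le_trans (ler_norm _) _.
    apply: le_trans (lip _ _ _ _ _ _ _ _) _; rewrite ?lexx ?ler01//.
    by rewrite subrr normr0 add0r subr0 normr1 mulr1.
  apply: le_trans (ler_norm _) _; apply: le_trans (lip _ _ _ _ _ _ _ _) _;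
    rewrite ?lexx ?ler01 ?x0 ?x1// ?leq_addr//.
  by rewrite subrr normr0 add0r sub0r normrN normr1 mulr1.
set S := \sum_(_ <= _ < _) _ => S2.
(* Diagonal k starts within [x m] of (0, 0) and ends within 2 * [x m] of (1, 1), in the sum
   distance; hence the 3. *)
suff : m%:R * (`|G 1 1 - G 0 0| - 3 * L * x m) <= S.
  have -> : m%:R * (`|G 1 1 - G 0 0| - 3 * L * x m) =
      m%:R * `|G 1 1 - G 0 0| - 3 * L * (m%:R * x m) by ring.
  have : 3 * L * (m%:R * x m) <= 3 * L by rewrite ler_piMr// mulr_ge0.
  lra.
have -> : m%:R * (`|G 1 1 - G 0 0| - 3 * L * x m) =
    \sum_(0 <= k < m) (`|G 1 1 - G 0 0| - 3 * L * x m).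
  by rewrite sumr_const_nat subn0 mulr_natl.
rewrite /S !big_nat; apply: ler_sum => k /andP[_ km].
have kn : (k <= n)%N by rewrite (leq_trans (ltnW km))// leq_addl.
have Nn : (N <= n)%N by rewrite leq_addr.
have Nkn : (N + k <= n)%N by rewrite leq_add2l ltnW.
have xkm : x k <= x m by rewrite ler_pM2r ?invr_gt0// ler_nat ltnW.
have := lip 1 1 (x N) (x (N + k)%N); rewrite !x0 !x1// ler01 lexx.
move=> /(_ isT isT isT isT) h1.
have := lip 0 (x k) 0 0.
rewrite !x0 !x1// ler01 lexx subrr subr0 normr0 add0r (ger0_norm (x0 k)).
move=> /(_ isT isT isT isT) h2.
have {}h1 : `|G 1 1 - G (x N) (x (N + k)%N)| <= L * (2 * x m).
  apply: (le_trans h1); rewrite ler_wpM2l//.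
  rewrite !ger0_norm ?subr_ge0 ?x1// xD.
  have := x0 k; have xNm : x N + x m = 1 by rewrite -xD.
  lra.
have {}h2 : `|G 0 (x k) - G 0 0| <= L * x m.
  by apply: (le_trans h2); rewrite ler_wpM2l.
rewrite x00.
have -> : G 1 1 - G 0 0 = (G 1 1 - G (x N) (x (N + k)%N)) +
  ((G (x N) (x (N + k)%N) - G 0 (x k)) + (G 0 (x k) - G 0 0)) by ring.
have := ler_normD (G 1 1 - G (x N) (x (N + k)%N))
   ((G (x N) (x (N + k)%N) - G 0 (x k)) + (G 0 (x k) - G 0 0)).
have := ler_normD (G (x N) (x (N + k)%N) - G 0 (x k)) (G 0 (x k) - G 0 0).
lra.
Qed.

(** * Maps of constant speed on segments, and translation invariance *)

(** Segments of [K] go to geodesics of constant, possibly zero, speed; this makes sense without any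
    linear structure on [Y]. *)
Definition convex_affine (R : realType) (V : lmodType R) (Y : metricType R)
    (K : set V) (phi : V -> Y) :=
  forall x y t, K x -> K y -> 0 <= t <= 1 ->
    K (x + t *: (y - x)) /\
    mdist (phi x) (phi (x + t *: (y - x))) = t * mdist (phi x) (phi y).

Section convex_affine.
Context {R : realType} {V : lmodType R} {Y : metricType R}.
Context {K : set V} {phi : V -> Y} (aff : convex_affine K phi).
Implicit Types (x y w : V) (s t : R).

Let rho x y := mdist (phi x) (phi y).

Let rhoC x y : rho x y = rho y x. Proof. exact: metric_sym. Qed.

Let rho_triangle y x z : rho x z <= rho x y + rho y z.
Proof. exact: metric_triangle. Qed.

Lemma affine_dist_mid x y : K x -> K y ->
  rho x (2^-1 *: (x + y)) = 2^-1 * rho x y /\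
  rho (2^-1 *: (x + y)) y = 2^-1 * rho x y.
Proof.
have midE (u v : V) : 2^-1 *: (u + v) = u + 2^-1 *: (v - u).
  rewrite scalerBr scalerDr addrCA addrC; congr (_ + _).
  by rewrite -{2}[u]scale1r -scalerBl; congr (_ *: _); field.
move=> Kx Ky; split.
  by rewrite midE; have [_] := @aff x y 2^-1 Kx Ky ltac:(lra).
rewrite rhoC addrC midE.
by have [_] := @aff y x 2^-1 Ky Kx ltac:(lra); rewrite (metric_sym (phi y) (phi x)).
Qed.

Lemma affine_ray x w t : K x -> K (x + w) -> 0 <= t <= 1 -> K (x + t *: w).
Proof.
by move=> Kx Kw t01; have [] := aff Kx Kw t01; rewrite (addrC x w) addrK.
Qed.

(** Constant speed is used twice: from [x] to [x + d *: w], then backwards from there with ratio 1 -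
    c / d. *)
Lemma affine_dist_ray x w c d : K x -> K (x + w) -> 0 <= c <= 1 -> 0 <= d <= 1 ->
  rho (x + c *: w) (x + d *: w) = `|c - d| * rho x (x + w).
Proof.
move=> Kx Kw; wlog cd : c d / c <= d.
  move=> H c01 d01; have [/H|/ltW/H] := leP c d; first exact.
  by rewrite rhoC distrC; exact.
move=> c01 d01; have from0 t : 0 <= t <= 1 -> rho x (x + t *: w) = t * rho x (x + w).
  by move=> t01; have [_] := aff Kx Kw t01; rewrite {1}(addrC x w) addrK.
have [d0|d0] := eqVneq d 0.
  have -> : c = 0 by lra.
  by rewrite d0 subrr normr0 mul0r /rho mdistxx.
have Kd : K (x + d *: w) by exact: affine_ray.
have d_gt0 : 0 < d by rewrite lt_neqAle eq_sym d0/=; lra.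
have t01 : 0 <= 1 - c / d <= 1.
  have := divr_ge0 (proj1 (andP c01)) (ltW d_gt0).
  have : c / d <= 1 by rewrite ler_pdivrMr// mul1r.
  lra.
have [_] := aff Kd Kx t01.
have -> : x + d *: w + (1 - c / d) *: (x - (x + d *: w)) = x + c *: w.
  rewrite opprD addNKr scalerN scalerA -addrA -scalerBl.
  by congr (_ + _ *: _); field.
rewrite -/(rho _ _) -/(rho _ _) rhoC => ->; rewrite rhoC from0//.
rewrite distrC ger0_norm ?subr_ge0//; field.
by [].
Qed.

(** The crossing inequalities for [G] come from small parallelograms: a side is at most the sum of
    two half diagonals. The Lipschitz bound is [affine_dist_ray] along both rays. *)
Lemma affine_dist_translate x y w :
  K x -> K y -> K (x + w) -> K (y + w) -> rho x y = rho (x + w) (y + w).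
Proof.
move=> Kx Ky Kxw Kyw; pose G c d := rho (x + c *: w) (y + d *: w).
suff : G 0 0 = G 1 1 by rewrite /G !scale0r !addr0 !scale1r.
apply: (@crossing_diagonal _ _ (rho x (x + w) + rho y (y + w))).
  move=> c d e c0 d0 e0 ce de; rewrite /G.
  have K1 : K (x + c *: w) by apply: affine_ray => //; lra.
  have K2 : K (x + (c + e) *: w) by apply: affine_ray => //; lra.
  have K3 : K (y + d *: w) by apply: affine_ray => //; lra.
  have K4 : K (y + (d + e) *: w) by apply: affine_ray => //; lra.
  have [] := affine_dist_mid K1 K4; have [] := affine_dist_mid K2 K3.
  (* the two crossing segments have the same midpoint *)
  have -> : x + (c + e) *: w + (y + d *: w) = x + c *: w + (y + (d + e) *: w).
    by rewrite addrACA [RHS]addrACA -!scalerDl; congr (_ + _ *: _); ring.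
  set m := 2^-1 *: _ => h1 h2 h3 h4.
  have := rho_triangle m (x + c *: w) (y + d *: w).
  have := rho_triangle m (x + (c + e) *: w) (y + (d + e) *: w).
  lra.
move=> c d c' d' hc hd hc' hd'; rewrite /G.
have h1 := affine_dist_ray Kx Kxw hc hc'; have h2 := affine_dist_ray Ky Kyw hd hd'.
have := rho_triangle (x + c' *: w) (x + c *: w) (y + d *: w).
have := rho_triangle (y + d' *: w) (x + c' *: w) (y + d *: w).
have := rho_triangle (x + c *: w) (x + c' *: w) (y + d' *: w).
have := rho_triangle (y + d *: w) (x + c *: w) (y + d' *: w).
rewrite (rhoC (y + d' *: w)) (rhoC (x + c' *: w) (x + c *: w)) h1 h2.
have := mulr_ge0 (normr_ge0 (c - c')) (mdist_ge0 (phi y) (phi (y + w))).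
have := mulr_ge0 (normr_ge0 (d - d')) (mdist_ge0 (phi x) (phi (x + w))).
rewrite -!/(rho _ _) => ? ? ? ? ? ?.
by rewrite mulrDr !mulrDl ler_norml; lra.
Qed.

(** If a <= b, shrinking the segment from [y] to [x] by a / b stays in [K] and gives a translate of
    the segment from [y'] to [x']. *)
Lemma affine_dist_proportional x y x' y' a b :
    K x -> K y -> K x' -> K y' -> 0 <= a -> 0 <= b ->
  a *: (x - y) = b *: (x' - y') -> a * rho x y = b * rho x' y'.
Proof.
wlog ab : a b x y x' y' / a <= b.
  move=> H Kx Ky Kx' Ky' a0 b0 e; have [/H|/ltW/H] := leP a b; first exact.
  by move=> {}H; apply/esym/H.
move=> Kx Ky Kx' Ky' a0 b0 e; have [b00|b_neq0] := eqVneq b 0.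
  have -> : a = 0 by lra.
  by rewrite b00 !mul0r.
have ab01 : 0 <= a / b <= 1.
  have b_gt0 : 0 < b by rewrite lt_neqAle eq_sym b_neq0.
  by apply/andP; split; [exact: divr_ge0 | rewrite ler_pdivrMr// mul1r].
have [Kz rz] := aff Ky Kx ab01; set z := y + _ in Kz rz.
have zE : z + (y' - y) = x'.
  rewrite /z mulrC -scalerA e scalerA mulVf// scale1r.
  by rewrite [y + _]addrC addrACA subrr addr0 subrK.
have yE : y + (y' - y) = y' by rewrite addrC subrK.
have := @affine_dist_translate y z (y' - y) Ky Kz; rewrite zE yE => /(_ Ky' Kx').
rewrite /rho rz (metric_sym (phi y)) (metric_sym (phi y')) => <-.
by field.
Qed.

(** * The seminorm on the span of K - K *)

(** For nonempty convex [K] this cone is already the linear span of K - K. *)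
Definition diff_span : {pred V} := fun w =>
  `[< exists s x y, [/\ 0 <= s, K x, K y & w = s *: (x - y)] >].

(** The value does not depend on the representation of [w], by [affine_dist_proportional]; it is 0
    off the span. *)
Definition diff_seminorm w : R := xget 0 [set r | exists s x y,
  [/\ 0 <= s, K x, K y & w = s *: (x - y) /\ r = s * mdist (phi x) (phi y)]].

Lemma diff_spanP w :
  reflect (exists s x y, [/\ 0 <= s, K x, K y & w = s *: (x - y)])
          (w \in diff_span).
Proof. exact: asboolP. Qed.

Lemma diff_spanE s x y : 0 <= s -> K x -> K y -> s *: (x - y) \in diff_span.
Proof. by move=> *; apply/diff_spanP; exists s, x, y. Qed.

Lemma diff_spanB x y : K x -> K y -> x - y \in diff_span.
Proof. by move=> *; rewrite -[x - y]scale1r diff_spanE. Qed.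

Lemma diff_seminormE s x y : 0 <= s -> K x -> K y ->
  diff_seminorm (s *: (x - y)) = s * rho x y.
Proof.
move=> s0 Kx Ky; rewrite /diff_seminorm; apply: xget_unique.
  by exists s, x, y.
move=> _ [t [x' [y' [t0 Kx' Ky' [e ->]]]]].
by apply: affine_dist_proportional.
Qed.

(** With l = s / (s + t), take P = l x + (1 - l) x' and Q = l y + (1 - l) y'. The intermediate point
    M = l y + (1 - l) x' splits P - Q into multiples of x - y and x' - y', and the triangle
    inequality at M gives subadditivity. *)
Lemma diff_span_add_repr s t x y x' y' :
    0 <= s -> 0 <= t -> K x -> K y -> K x' -> K y' -> exists P Q, [/\ K P, K Q,
  s *: (x - y) + t *: (x' - y') = (s + t) *: (P - Q) &
  (s + t) * rho P Q <= s * rho x y + t * rho x' y'].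
Proof.
move=> s0 t0 Kx Ky Kx' Ky'; have [st0|st_neq0] := eqVneq (s + t) 0.
  have [-> ->] : s = 0 /\ t = 0 by lra.
  by exists x, x; rewrite !addr0 !scale0r !mul0r addr0.
have st_gt0 : 0 < s + t by rewrite lt_neqAle eq_sym st_neq0 addr_ge0.
pose l := s / (s + t).
have l01 : 0 <= l <= 1.
  apply/andP; split; first by rewrite divr_ge0// ltW.
  by rewrite ler_pdivrMr// mul1r lerDl.
have [KP _] := aff Kx' Kx l01; have [KM _] := aff Kx' Ky l01.
have [KQ _] := aff Ky' Ky l01.
set P := x' + _ in KP; set M := x' + _ in KM; set Q := y' + _ in KQ.
have stl : (s + t) * l = s by rewrite /l; field.
have PM : (s + t) *: (P - M) = s *: (x - y).
  rewrite /P /M opprD addrACA subrr add0r -scalerBr scalerA stl.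
  by rewrite opprB addrA subrK.
have MQ : (s + t) *: (M - Q) = t *: (x' - y').
  rewrite /M /Q opprD addrACA -scalerBr.
  have -> : y - x' - (y - y') = - (x' - y') by rewrite !opprB addrC addrA subrK.
  rewrite scalerN -{1}[x' - y']scale1r -scalerBl scalerA; congr (_ *: _).
  by rewrite mulrBr stl; ring.
exists P, Q; split=> //.
  by rewrite -PM -MQ -scalerDr addrA subrK.
rewrite -(affine_dist_proportional KP KM Kx Ky (ltW st_gt0) s0 PM).
rewrite -(affine_dist_proportional KM KQ Kx' Ky' (ltW st_gt0) t0 MQ).
by rewrite -mulrDr ler_pM2l.
Qed.

Lemma diff_spanD : {in diff_span &, forall u v, u + v \in diff_span}.
Proof.
move=> _ _ /diff_spanP[s [x [y [s0 Kx Ky ->]]]]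
  /diff_spanP[t [x' [y' [t0 Kx' Ky' ->]]]].
have [P [Q [KP KQ -> _]]] := diff_span_add_repr s0 t0 Kx Ky Kx' Ky'.
by rewrite diff_spanE// addr_ge0.
Qed.

Lemma diff_seminormD : {in diff_span &, forall u v,
  diff_seminorm (u + v) <= diff_seminorm u + diff_seminorm v}.
Proof.
move=> _ _ /diff_spanP[s [x [y [s0 Kx Ky ->]]]]
  /diff_spanP[t [x' [y' [t0 Kx' Ky' ->]]]].
have [P [Q [KP KQ -> le]]] := diff_span_add_repr s0 t0 Kx Ky Kx' Ky'.
by rewrite !diff_seminormE// addr_ge0.
Qed.

Lemma diff_seminormZ a : {in diff_span, forall u, a *: u \in diff_span /\
  diff_seminorm (a *: u) = `|a| * diff_seminorm u}.
Proof.
move=> _ /diff_spanP[s [x [y [s0 Kx Ky ->]]]].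
rewrite scalerA (diff_seminormE s0 Kx Ky) mulrA.
have [a0|a0] := leP 0 a.
  by rewrite diff_seminormE ?diff_spanE ?mulr_ge0 ?ger0_norm.
have -> : (a * s) *: (x - y) = (- a * s) *: (y - x).
  by rewrite -opprB scalerN mulNr scaleNr.
have as0 : 0 <= - a * s by rewrite mulr_ge0// oppr_ge0 ltW.
by rewrite diff_seminormE// diff_spanE// rhoC ltr0_norm.
Qed.

End convex_affine.

(** * Quotient of a seminormed space by its kernel *)

Record seminorm (R : realType) (U : lmodType R) := Seminorm {
  seminorm_fun :> U -> R;
  seminormD : forall x y, seminorm_fun (x + y) <= seminorm_fun x + seminorm_fun y;
  seminormZ : forall a x, seminorm_fun (a *: x) = `|a| * seminorm_fun x }.

Section seminorm_quotient.
Context {R : realType} {U : lmodType R} (p : seminorm U).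
Local Open Scope quotient_scope.

Lemma seminorm0 : p 0 = 0.
Proof. by rewrite -(scale0r 0) seminormZ normr0 mul0r. Qed.

Lemma seminormN x : p (- x) = p x.
Proof. by rewrite -scaleN1r seminormZ normrN normr1 mul1r. Qed.

Lemma seminorm_ge0 x : 0 <= p x.
Proof. by have := seminormD p x (- x); rewrite subrr seminorm0 seminormN; lra. Qed.

Definition seminorm_ker : {pred U} := [pred x | p x == 0].

Lemma seminorm_ker_zmod_closed : zmod_closed seminorm_ker.
Proof.
split=> [|x y]; rewrite !inE ?seminorm0// => /eqP x0 /eqP y0.
rewrite eq_le seminorm_ge0 andbT (le_trans (seminormD _ _ _))//.
by rewrite seminormN x0 y0 addr0.
Qed.

HB.instance Definition _ :=
  GRing.isZmodClosed.Build U seminorm_ker seminorm_ker_zmod_closed.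

Definition seminorm_quot : Type := Quotient.quot seminorm_ker.

HB.instance Definition _ := GRing.Zmodule.on seminorm_quot.

Definition seminorm_pi (x : U) : seminorm_quot := \pi_(Quotient.quot seminorm_ker) x.

Lemma seminorm_piD x y : seminorm_pi (x + y) = seminorm_pi x + seminorm_pi y.
Proof. exact: raddfD. Qed.

Lemma seminorm_piB x y : seminorm_pi (x - y) = seminorm_pi x - seminorm_pi y.
Proof. exact: raddfB. Qed.

Lemma seminorm_pi_eq x y : (seminorm_pi x = seminorm_pi y) <-> p (x - y) = 0.
Proof.
have := Quotient.idealrBE (seminorm_ker : zmodClosed U) x y.
rewrite inE /seminorm_pi => h; split=> [/eqP|/eqP]; [rewrite -h|rewrite h]; by move/eqP.
Qed.

Definition seminorm_repr (q : seminorm_quot) : U :=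
  repr (q : Quotient.quot seminorm_ker).

Lemma seminorm_reprK : cancel seminorm_repr seminorm_pi.
Proof. exact: reprK. Qed.

Let scale (a : R) (q : seminorm_quot) := seminorm_pi (a *: seminorm_repr q).

Let scaleE a x : scale a (seminorm_pi x) = seminorm_pi (a *: x).
Proof.
apply/seminorm_pi_eq; rewrite -scalerBr seminormZ.
by rewrite (seminorm_pi_eq _ _).1 ?mulr0// seminorm_reprK.
Qed.

Let scaleA a b q : scale a (scale b q) = scale (a * b) q.
Proof. by rewrite -[q]seminorm_reprK !scaleE scalerA. Qed.

Let scale1 : left_id 1 scale.
Proof. by move=> q; rewrite -[q]seminorm_reprK scaleE scale1r. Qed.

Let scaleDr : right_distributive scale +%R.
Proof.
move=> a q r; rewrite -[q]seminorm_reprK -[r]seminorm_reprK.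
by rewrite -seminorm_piD !scaleE -seminorm_piD scalerDr.
Qed.

Let scaleDl q : {morph scale^~ q : a b / a + b}.
Proof.
by move=> a b; rewrite -[q]seminorm_reprK !scaleE scalerDl seminorm_piD.
Qed.

HB.instance Definition _ :=
  GRing.Zmodule_isLmodule.Build R seminorm_quot scaleA scale1 scaleDr scaleDl.

Lemma seminorm_piZ a x : seminorm_pi (a *: x) = a *: seminorm_pi x.
Proof. by rewrite -scaleE. Qed.

Let norm (q : seminorm_quot) := p (seminorm_repr q).

(** Subadditivity makes [p] constant on classes modulo its kernel. *)
Let normE x : norm (seminorm_pi x) = p x.
Proof.
have : p (seminorm_repr (seminorm_pi x) - x) = 0.
  by apply/seminorm_pi_eq; rewrite seminorm_reprK.
rewrite /norm; set y := seminorm_repr _ => yx.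
apply/eqP; rewrite eq_le; apply/andP; split.
  by have := seminormD p (y - x) x; rewrite subrK yx add0r.
by have := seminormD p (x - y) y; rewrite subrK -[p (x - y)]seminormN opprB yx add0r.
Qed.

Let normD q r : norm (q + r) <= norm q + norm r.
Proof.
rewrite -[q]seminorm_reprK -[r]seminorm_reprK -seminorm_piD !normE.
exact: seminormD.
Qed.

Let normZ a q : norm (a *: q) = `|a| * norm q.
Proof. by rewrite -[q]seminorm_reprK -seminorm_piZ !normE seminormZ. Qed.

Let norm_eq0 q : norm q = 0 -> q = 0.
Proof.
rewrite -[q]seminorm_reprK normE => q0.
rewrite -[RHS](subrr (seminorm_pi 0)) -seminorm_piB subr0.
by apply/seminorm_pi_eq; rewrite subr0.
Qed.

HB.instance Definition _ :=
  Lmodule_isNormed.Build R seminorm_quot normD normZ norm_eq0.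

Lemma normr_seminorm_pi x : `|seminorm_pi x| = p x.
Proof. exact: normE. Qed.

End seminorm_quotient.

(** * Realization of the image in a normed space *)

(** Equal distances give [a] and [b] the same fibres, so a section of one followed by the other is a
    bijection. *)
Lemma isometric_param (R : realType) (I : Type) (M N : metricType R)
    (a : I -> M) (b : I -> N) :
    (forall x, exists i, a i = x) -> (forall y, exists i, b i = y) ->
    (forall i j, mdist (a i) (a j) = mdist (b i) (b j)) ->
  isometric M N.
Proof.
move=> /choice[sa aK] /choice[sb bK] ab.
exists (b \o sa); last by move=> x y; rewrite /= -ab !aK.
exists (a \o sb) => [x|y] /=; apply: mdist_positivity.
  by rewrite -{2}(aK x) ab bK mdistxx.
by rewrite -{2}(bK y) -ab aK mdistxx.
Qed.

Record submod_of (R : pzRingType) (V : lmodType R) (S : submodClosed V) :=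
  Submod { submod_val : V; submod_valP : submod_val \in S }.

Section submod_of.
Context {R : pzRingType} {V : lmodType R} (S : submodClosed V).

HB.instance Definition _ := [isSub for @submod_val R V S].
HB.instance Definition _ := [Choice of submod_of S by <:].
HB.instance Definition _ := [SubChoice_isSubLmodule of submod_of S by <:].

End submod_of.

Lemma seminorm_on_realization (R : realType) (V : lmodType R) (S : {pred V})
    (p : V -> R) :
    0 \in S -> {in S &, forall u v, u + v \in S /\ p (u + v) <= p u + p v} ->
    (forall a, {in S, forall u, a *: u \in S /\ p (a *: u) = `|a| * p u}) ->
  exists (E : normedModType R) (T : V -> E), [/\
    {in S &, {morph T : u v / u + v}},
    forall a, {in S, {morph T : u / a *: u}} &
    {in S, forall u, `|T u| = p u}].
Proof.
move=> S0 SD SZ.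
have Scl : GRing.subsemimod_closed S.
  split; last by move=> a u uS; have [] := SZ a u uS.
  by split=> // u v uS vS; have [] := SD u v uS vS.
pose SC : submodClosed V := HB.pack S (GRing.isSubmodClosed.Build R V S Scl).
pose q (u : submod_of SC) := p (val u).
have qD u v : q (u + v) <= q u + q v.
  by have [_] := SD _ _ (submod_valP u) (submod_valP v).
have qZ a u : q (a *: u) = `|a| * q u by have [_] := SZ a _ (submod_valP u).
pose P := Seminorm qD qZ.
(* Off [S], [insubd] returns 0; the laws for [T] are only claimed on [S]. *)
exists (seminorm_quot P), (fun u => seminorm_pi P (insubd 0 u)); split=> /=.
- move=> u v uS vS; rewrite -seminorm_piD; congr seminorm_pi; apply/val_inj.
  by rewrite /= !insubdK//; have [] := SD u v uS vS.
- move=> a u uS; rewrite -seminorm_piZ; congr seminorm_pi; apply/val_inj.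
  by rewrite /= !insubdK//; have [] := SZ a u uS.
- by move=> u uS; rewrite normr_seminorm_pi /= /q insubdK.
Qed.

Lemma conv_lmodE (R : numDomainType) (V : lmodType R) (l : {i01 R})
    (x y : convex_lmodType V) : conv l x y = (y : V) + l%:num *: ((x : V) - y).
Proof. by rewrite /conv/= scalerBr scalerBl scale1r addrCA. Qed.

(** Subtracting a base point [x0] brings [K] into the span, where [T] acts. The resulting [J]
    respects convex combinations and induces the same distances on [K] as [phi], so [K] parametrizes
    both images. *)
Theorem affine_image (R : realType) (V : lmodType R) (Y : metricType R)
    (K : set V) (phi : V -> Y) :
  convex_affine K phi -> K !=set0 -> affine (set_type (phi @` K)).
Proof.
move=> aff [x0 Kx0]; pose S := @diff_span R V K.
have S0 : 0 \in S by rewrite -(subrr x0) diff_spanB.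
have [E [T [TD TZ Tnorm]]] := seminorm_on_realization S0
  (fun u v uS vS => conj (diff_spanD aff uS vS) (diff_seminormD aff uS vS))
  (diff_seminormZ aff).
pose J x := T (x - x0).
have JB x y : K x -> K y -> J x - J y = T (x - y).
  move=> Kx Ky; rewrite /J -[- T _]scaleN1r -TZ ?diff_spanB// scaleN1r opprB.
  by rewrite -TD ?diff_spanB// addrA subrK.
have JE x y : K x -> K y -> `|J x - J y| = mdist (phi x) (phi y).
  move=> Kx Ky; rewrite JB// Tnorm ?diff_spanB// -[x - y]scale1r.
  by rewrite (diff_seminormE aff)// mul1r.
exists E, (J @` K); split.
  move=> _ _ l /set_mem[x Kx <-] /set_mem[y Ky <-].
  have l01 : 0 <= (l%:num : R) <= 1 by apply/andP; split.
  have [Kz _] := aff y x _ Ky Kx l01.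
  have lS : l%:num *: (x - y) \in S.
    by have [] := diff_seminormZ aff l%:num (diff_spanB Kx Ky).
  have Jz : J (y + l%:num *: (x - y)) = J y + l%:num *: (J x - J y).
    rewrite (JB x y Kx Ky) -(TZ _ _ (diff_spanB Kx Ky)).
    by rewrite /J -(TD _ _ (diff_spanB Ky Kx0) lS) addrAC.
  by rewrite conv_lmodE -Jz; apply/mem_set; exists (y + l%:num *: (x - y)).
pose a (i : set_type K) : set_type (phi @` K) :=
  SigSub (mem_set (imageP phi (set_valP i))).
pose b (i : set_type K) : set_type (J @` K : set (normed_metric E)) :=
  SigSub (mem_set (imageP (J : V -> normed_metric E) (set_valP i))).
apply: (@isometric_param _ _ _ _ a b).
- move=> y; have [x Kx e] := set_valP y.
  by exists (SigSub (mem_set Kx)); apply/val_inj.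
- move=> y; have [x Kx e] := set_valP y.
  by exists (SigSub (mem_set Kx)); apply/val_inj.
- by move=> i j; rewrite [RHS]JE; [|exact: set_valP..].
Qed.

(** * Equality in Minkowski's inequality and the product *)

(* Equality case of Minkowski's inequality [D <= t * D + (1 - t) * D] for the  *)
(* vectors (r, s), (a, c) and (b, e). *)
Lemma l2_segment_split (R : realDomainType) (t D r s a b c e : R) :
    0 < t < 1 -> 0 <= r -> 0 <= s -> 0 <= a -> 0 <= b -> 0 <= c -> 0 <= e ->
    r ^+ 2 + s ^+ 2 = D ^+ 2 -> a ^+ 2 + c ^+ 2 = (t * D) ^+ 2 ->
    b ^+ 2 + e ^+ 2 = ((1 - t) * D) ^+ 2 -> r <= a + b -> s <= c + e ->
  a = t * r.
Proof.
move=> t01 r0 s0 a0 b0 c0 e0 rs ac be rab sce.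
have r2 : r ^+ 2 <= (a + b) ^+ 2 by rewrite ler_sqr// nnegrE addr_ge0.
have s2 : s ^+ 2 <= (c + e) ^+ 2 by rewrite ler_sqr// nnegrE addr_ge0.
(* [X] and [Z] measure the failure of (a, c) and (b, e) to be in ratio t : 1 - t, and [W] the slack
   in the two triangle inequalities. The identity [XZW] forces all three to vanish. *)
pose X := (1 - t) * a - t * b; pose Z := (1 - t) * c - t * e.
pose W := ((a + b) ^+ 2 - r ^+ 2) + ((c + e) ^+ 2 - s ^+ 2).
have XZW : X ^+ 2 + Z ^+ 2 + t * (1 - t) * W = 0.
  transitivity ((1 - t) * (a ^+ 2 + c ^+ 2) + t * (b ^+ 2 + e ^+ 2)
                - t * (1 - t) * (r ^+ 2 + s ^+ 2)).
    by rewrite /X /Z /W; ring.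
  by rewrite ac be rs; ring.
have tt0 : 0 < t * (1 - t) by rewrite mulr_gt0//; lra.
have W_ge0 : 0 <= W by rewrite /W; lra.
have tW_ge0 := mulr_ge0 (ltW tt0) W_ge0.
have X2_ge0 := sqr_ge0 X; have Z2_ge0 := sqr_ge0 Z.
have /eqP : X ^+ 2 = 0 by lra.
rewrite sqrf_eq0 => /eqP X0.
have /eqP : t * (1 - t) * W = 0 by lra.
rewrite mulf_eq0 (gt_eqF tt0)/= => /eqP W0.
have /eqP : (a + b) ^+ 2 = r ^+ 2 by move: W0; rewrite /W; lra.
rewrite eqrXn2 ?addr_ge0// => /eqP <-.
by move: X0; rewrite /X; lra.
Qed.

Theorem proposition1p4 (R : realType) (Y Ybar : metricType R)
    (C : set (dprod Y Ybar)) :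
  affine (set_type C) -> affine (set_type (@dprod_fst Y Ybar @` C)).
Proof.
move=> [V [K [cvxK [f [g fK gK] fmono]]]].
(* A base point is needed below; if [K] is empty, so is [C], and [K] itself is the model. *)
have [v0|/set0P K0] := eqVneq K set0.
  have noK (k : set_type (K : set (normed_metric V))) : False.
    by have := set_valP k; rewrite {1}v0.
  have noC (y : set_type (@dprod_fst Y Ybar @` C)) : False.
    by have [p Cp _] := set_valP y; exact: noK (f (SigSub (mem_set Cp))).
  exists V, K; split=> //.
  apply: (isometric_param (a := of_void _) (b := of_void _)) => [y|k|[]].
    by case: (noC y).
  by case: (noK k).
have [x0 Kx0] := K0.
pose k0 : set_type K := SigSub (mem_set Kx0).
(* [g] extended to all of [V], with the value at [k0] outside [K]. *)
pose gV (x : V) : dprod Y Ybar := set_val (g (insubd k0 x)).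
have gVC x : C (gV x) by exact: set_valP.
have gVdist x y : K x -> K y ->
    mdist (gV x).1 (gV y).1 ^+ 2 + mdist (gV x).2 (gV y).2 ^+ 2 = `|x - y| ^+ 2.
  move=> Kx Ky; have := fmono (g (insubd k0 x)) (g (insubd k0 y)).
  rewrite !gK => /esym.
  have -> : mdist (insubd k0 x : set_type (K : set (normed_metric V)))
                  (insubd k0 y) = `|x - y|.
    rewrite -[in RHS](@insubdK _ _ _ k0 x) ?inE//.
    by rewrite -[in RHS](@insubdK _ _ _ k0 y) ?inE.
  move=> <-; rewrite [mdist _ _ in RHS](_ : _ = dprod_dist (gV x) (gV y))//.
  by rewrite sqr_sqrtr// addr_ge0 ?sqr_ge0.
pose phi x := (gV x).1.
have -> : @dprod_fst Y Ybar @` C = phi @` K.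
  apply/seteqP; split => [_ [p Cp <-]|_ [x Kx <-]]; last by exists (gV x).
  pose k := f (SigSub (mem_set Cp)).
  exists (set_val k); first exact: set_valP.
  by rewrite /phi /gV /= valKd /k fK.
apply: affine_image; last by exists x0.
move=> x y t Kx Ky /andP[t0 t1].
have Kz : K (x + t *: (y - x)).
  pose l := Itv01 t0 t1.
  have /set_mem := cvxK y x l (mem_set Ky) (mem_set Kx).
  by rewrite conv_lmodE.
split=> //.
have [->|tn0] := eqVneq t 0; first by rewrite scale0r addr0 mul0r mdistxx.
have [->|tn1] := eqVneq t 1; first by rewrite scale1r addrC subrK mul1r.
have t01 : 0 < t < 1 by rewrite !lt_neqAle eq_sym tn0 tn1 t0.
(* Here D is the norm of [x - y]; the sides (a, c) and (b, e) are the two pieces cut by the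
   intermediate point. *)
apply: (l2_segment_split t01 _ _ _ _ _ _ (gVdist x y Kx Ky)
  (a := mdist (phi x) (phi (x + t *: (y - x))))
  (b := mdist (phi (x + t *: (y - x))) (phi y))
  (c := mdist (gV x).2 (gV (x + t *: (y - x))).2)
  (e := mdist (gV (x + t *: (y - x))).2 (gV y).2)) => //;
  try exact: mdist_ge0; try exact: metric_triangle.
- by rewrite gVdist// opprD addNKr normrN normrZ ger0_norm// (distrC y x).
- rewrite gVdist//.
  have -> : x + t *: (y - x) - y = (1 - t) *: (x - y).
    by rewrite scalerBl scale1r addrAC -scalerN opprB.
  by rewrite normrZ ger0_norm// subr_ge0.
Qed.
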